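(* Let $L=\{E\}$ be the language of (finite, undirected, loopless) graphs, and consider the properties $\phi_{\rm none}(x)$: ''$x$ is an isolated node'', i.e. $(\forall y)\neg(xEy)$; $\phi_{\rm all}(x)$: ''$x$ is adjacent to every other node'', i.e. $(\forall y)(y\neq x\rightarrow xEy)$; $\phi_{\rm one}(x)$: ''$x$ is adjacent to exactly one node'', i.e. $(\exists! y)(xEy)$. Then $d(\phi_{\rm none}:\mathrm{typ})=d(\phi_{\rm all}:\mathrm{typ})=d(\phi_{\rm one}:\mathrm{typ})=0$.
   Context: $L$-structures are graphs $G=\langle A,E\rangle$ with $E$ a symmetric irreflexive binary relation on $A$; $\mathbf{S}_n(L)$ is the set of all such graphs with node set $\{1,\ldots,n\}$, so $|\mathbf{S}_n(L)|=2^{\binom{n}{2}}$. For a first-order formula $\phi(x)$ of $L$ with one free variable and a graph $G$ with node set $A$, $\phi(G)=\{a\in A:G\models\phi(a)\}$. Let $\mathbf{S}_n(\phi:\mathrm{typ})=\{G\in\mathbf{S}_n(L):|\phi(G)|>n/2\}$, $d_n(\phi:\mathrm{typ})=|\mathbf{S}_n(\phi:\mathrm{typ})|/|\mathbf{S}_n(L)|$, and $d(\phi:\mathrm{typ})=\lim_{n\to\infty}d_n(\phi:\mathrm{typ})$ whenever this limit exists. *)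

(* Defs.v *)
From HB Require Import structures.
From mathcomp Require Import all_boot all_order all_algebra.
From mathcomp Require Import all_classical all_reals all_analysis.

Set Implicit Arguments.
Unset Strict Implicit.
Unset Printing Implicit Defensive.

Import Order.TTheory GRing.Theory Num.Theory.
Import numFieldNormedType.Exports.

Local Open Scope ring_scope.
Local Open Scope classical_set_scope.

Section Graphs.
Variable A : finType.

Definition is_graph (E : {ffun A * A -> bool}) : bool :=
  [forall a, forall b, E (a, b) == E (b, a)] && [forall a, ~~ E (a, a)].

Record graph := Graph { edges : {ffun A * A -> bool}; _ : is_graph edges }.

HB.instance Definition _ := [isSub for edges].
HB.instance Definition _ := [Finite of graph by <:].

Definition adj (G : graph) (a b : A) : bool := edges G (a, b).

End Graphs.

(* First-order formulas of the language {E} with equality; variables are named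
   by natural numbers. *)
Inductive formula : Type :=
| Equal of nat & nat
| Edge of nat & nat
| Not of formula
| And of formula & formula
| Or of formula & formula
| Imp of formula & formula
| All of nat & formula
| Ex of nat & formula.

Fixpoint free_vars (phi : formula) : seq nat :=
  match phi with
  | Equal i j | Edge i j => [:: i; j]
  | Not p => free_vars p
  | And p q | Or p q | Imp p q => free_vars p ++ free_vars q
  | All i p | Ex i p => [seq j <- free_vars p | j != i]
  end.

Definition update (A : Type) (s : nat -> A) (i : nat) (a : A) : nat -> A :=
  fun j => if j == i then a else s j.

Fixpoint sat (A : finType) (G : graph A) (s : nat -> A) (phi : formula) : bool :=
  match phi with
  | Equal i j => s i == s j
  | Edge i j => adj G (s i) (s j)
  | Not p => ~~ sat G s p
  | And p q => sat G s p && sat G s q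
  | Or p q => sat G s p || sat G s q
  | Imp p q => sat G s p ==> sat G s q
  | All i p => [forall a, sat G (update s i a) p]
  | Ex i p => [exists a, sat G (update s i a) p]
  end.

(* Formulas phi(x), with x the variable number 0 and no other free variable. *)
Definition formula1 : Type :=
  {phi : formula | all (pred1 0%N) (free_vars phi)}.

(* phi(G).  As only variable 0 is free in phi, the values that the assignment
   gives to the other variables are irrelevant. *)
Definition solutions (A : finType) (phi : formula1) (G : graph A) : {set A} :=
  [set a | sat G (fun=> a) (sval phi)]%SET.

(* The node set {1, ..., n} is rendered as 'I_n = {0, ..., n-1}. *)
Definition graphs (n : nat) : {set graph 'I_n} := [set: graph 'I_n]%SET.

Definition typ_graphs (phi : formula1) (n : nat) : {set graph 'I_n} :=
  [set G in graphs n | n%:R / 2%:R < #|solutions phi G|%:R :> rat]%SET.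

Definition dn_typ (R : realType) (phi : formula1) (n : nat) : R :=
  #|typ_graphs phi n|%:R / #|graphs n|%:R.

(* d(phi : typ) exists and equals l. *)
Definition d_typ_is (R : realType) (phi : formula1) (l : R) : Prop :=
  dn_typ R phi n @[n --> \oo] --> l.

(* exists! i, p, where k is a variable distinct from i that does not occur in p;
   the caller supplies pk, the formula p with k in place of i. *)
Definition ExUnique (i k : nat) (p pk : formula) : formula :=
  Ex i (And p (All k (Imp pk (Equal k i)))).

Definition phi_none : formula1 :=
  exist _ (All 1 (Not (Edge 0 1))) erefl.

Definition phi_all : formula1 :=
  exist _ (All 1 (Imp (Not (Equal 1 0)) (Edge 0 1))) erefl.

Definition phi_one : formula1 :=
  exist _ (ExUnique 1 2 (Edge 0 1) (Edge 0 2)) erefl.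

(* Main.v *)
(** Given a node [a] and a set [S] of other nodes, exchanging the edges and the
    non-edges between [a] and [S] is an involution on graphs.  Hence the
    neighbourhood of [a] in a random graph on [n] nodes is uniformly
    distributed over the subsets of the other nodes.  Each of the three
    properties allows at most [n] neighbourhoods, so it holds at [a] with
    probability at most [n / 2 ^ (n - 1)]; by Markov's inequality it holds at
    more than half of the nodes with probability at most twice that. *)
Require Import Defs.
From mathcomp Require Import all_boot all_order all_algebra.
From mathcomp Require Import all_classical all_reals all_analysis.
From mathcomp Require Import zify.

Set Implicit Arguments.
Unset Strict Implicit.
Unset Printing Implicit Defensive.

Import Order.TTheory GRing.Theory Num.Theory.
Import numFieldNormedType.Exports.

Section Neighbourhoods.
Variable A : finType.
Implicit Types (G : graph A) (a b : A) (S T : {set A}).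

Definition neighbours G a : {set A} := [set b | adj G a b]%SET.

Lemma adjC G a b : adj G a b = adj G b a.
Proof. by have /andP[/forallP/(_ a)/forallP/(_ b)/eqP] := valP G. Qed.

Lemma adjxx G a : adj G a a = false.
Proof. by have /andP[_ /forallP/(_ a)/negbTE] := valP G. Qed.

Lemma graph_ext G H : (forall x y, adj G x y = adj H x y) -> G = H.
Proof. by move=> eqGH; apply/val_inj/ffunP => -[x y]; apply: eqGH. Qed.

(** The guard [x != y] keeps the toggled relation irreflexive even when [a \in T], so [toggle] is
    defined for every set [T]. *)
Definition in_star a T (x y : A) : bool :=
  (x != y) && ((x == a) && (y \in T) || (y == a) && (x \in T)).

Definition toggle_edges a T G : {ffun A * A -> bool} :=
  [ffun p => adj G p.1 p.2 (+) in_star a T p.1 p.2].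

Lemma toggle_is_graph a T G : is_graph (toggle_edges a T G).
Proof.
apply/andP; split; last by apply/forallP => x; rewrite ffunE /= adjxx /in_star eqxx.
apply/forallP => x; apply/forallP => y.
by rewrite !ffunE /= adjC /in_star (eq_sym x y) orbC.
Qed.

Definition toggle a T G : graph A := Graph (toggle_is_graph a T G).

Lemma adj_toggle a T G x y : adj (toggle a T G) x y = adj G x y (+) in_star a T x y.
Proof. by rewrite {1}/adj ffunE. Qed.

Lemma toggleK a T : involutive (toggle a T).
Proof. by move=> G; apply: graph_ext => x y; rewrite !adj_toggle addbK. Qed.

(** The map sending [(G, T)], with [neighbours G a == S] and [T] avoiding [a], to [toggle a T G] is
    injective: the neighbourhood of [a] in the image is the symmetric difference of [S] and [T],
    which determines [T], and toggling again recovers [G]. *)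
Lemma card_neighbours_eq a S :
  (#|[set G | neighbours G a == S]%SET| * 2 ^ #|A|.-1 <= #|{: graph A}|)%N.
Proof.
have -> : #|A|.-1 = #|[set~ a]%SET| by rewrite cardsC1.
rewrite -card_powerset -cardsX.
rewrite -(card_in_imset (f := fun p => toggle a p.2 p.1)) ?max_card//.
move=> [G T] [H U]; rewrite !inE /= => /andP[/eqP GS TA] /andP[/eqP HS UA] eqGH.
have eqTU : T = U.
  apply/setP => b; have [->|neq_ba] := eqVneq b a.
    move/fintype.subsetP/(_ a)/contraNN: TA; move/fintype.subsetP/(_ a)/contraNN: UA.
    by rewrite !inE eqxx => /(_ isT)/negbTE-> /(_ isT)/negbTE->.
  have : b \in neighbours G a = (b \in neighbours H a) by rewrite GS HS.
  have := congr1 (fun K => adj K a b) eqGH.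
  rewrite !adj_toggle !inE /in_star eqxx eq_sym neq_ba (negbTE neq_ba) /= !orbF.
  by move=> /[swap] -> /addbI.
by move: eqGH; rewrite eqTU => /(can_inj (toggleK a U)) ->.
Qed.

Lemma card_neighbours_in a (F : {set {set A}}) :
  (#|[set G | neighbours G a \in F]%SET| * 2 ^ #|A|.-1
    <= #|F| * #|{: graph A}|)%N.
Proof.
have -> : #|[set G | neighbours G a \in F]%SET|
    = (\sum_(S in F) #|[set G | neighbours G a == S]%SET|)%N.
  rewrite -sum1_card.
  rewrite (partition_big (fun G => neighbours G a) (mem F)) /=; last first.
    by move=> G; rewrite inE.
  apply: eq_bigr => S SF; rewrite -sum1_card; apply: eq_bigl => G.
  by rewrite !inE; case: eqP => [->|]; rewrite ?SF ?andbF.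
rewrite big_distrl -sum_nat_const; apply: leq_sum => S _.
exact: card_neighbours_eq.
Qed.

End Neighbourhoods.

Lemma sqr_le_exp2 m : (m.+1 * m.+1 <= 4 * 2 ^ m)%N.
Proof.
(* The inductive step needs [(k + 2)^2 <= 2 * (k + 1)^2], which fails for [k = 0] and [k = 1]; those
   steps are computed directly. *)
elim: m => // -[|[|m]] // IHm.
by rewrite expnS; move: (2 ^ _)%N IHm => N; nia.
Qed.

Section FewNeighbourhoods.
Variables (phi : formula1) (F : forall n, 'I_n -> {set {set 'I_n}}).
Hypothesis card_F : forall n (a : 'I_n), (#|F a| <= n)%N.
Hypothesis solutionsF : forall n (G : graph 'I_n) a,
  a \in solutions phi G -> neighbours G a \in F a.

(** The exponential decay is weakened to a bound of order [1 / n], enough for the limit. The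
    constant 8 is the 2 of Markov's inequality times the 4 of [sqr_le_exp2]. *)
Lemma card_typ_graphs m :
  (#|typ_graphs phi m.+1| * m.+1 <= 8 * #|graphs m.+1|)%N.
Proof.
set n := m.+1; set t := #|typ_graphs phi n|; set g := #|graphs n|.
have markov : (t * n <= 2 * \sum_(G : graph 'I_n) #|solutions phi G|)%N.
  rewrite /t -sum1_card big_distrl big_distrr /=.
  (* Atypical graphs are dropped from the sum; each typical one contributes more than [n / 2]. *)
  rewrite [leqRHS](bigID [in typ_graphs phi n]) /=.
  apply: leq_trans (leq_addr _ _); apply: leq_sum => G.
  rewrite inE => /andP[_]; rewrite ltr_pdivrMr// -natrM ltr_nat mulnC mul1n.
  exact: ltnW.
have double_count : (\sum_(G : graph 'I_n) #|solutions phi G|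
    = \sum_(a < n) #|[set G | a \in solutions phi G]%SET|)%N.
  under eq_bigr do rewrite -sum1_card big_mkcond.
  rewrite exchange_big; apply: eq_bigr => a _.
  by rewrite -sum1_card [RHS]big_mkcond; apply: eq_bigr => G _; rewrite inE.
have node_bound (a : 'I_n) :
    (#|[set G | a \in solutions phi G]%SET| * 2 ^ m <= n * g)%N.
  apply: (@leq_trans (#|F a| * g)); last by rewrite leq_mul2r card_F orbT.
  rewrite /g cardsT; have := card_neighbours_in a (F a).
  rewrite card_ord; apply: leq_trans; rewrite leq_mul2r; apply/orP; right.
  apply/subset_leq_card/fintype.subsetP => G; rewrite inE => aG; rewrite inE.
  exact: solutionsF.
have sum_bound : ((\sum_(G : graph 'I_n) #|solutions phi G|) * 2 ^ m
    <= n * (n * g))%N.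
  rewrite double_count big_distrl -[leqRHS](_ : \sum_(a < n) n * g = _)%N.
    exact: leq_sum.
  by rewrite sum_nat_const card_ord.
(* With [s] the sum and [N = 2 ^ m], the chain is [t * n * N <= 2 * s * N <= 2 * n^2 * g <= 8 * g *
   N]. *)
rewrite -(leq_pmul2r (expn_gt0 2 m)).
have := sqr_le_exp2 m; rewrite -/n.
by move: (\sum_(_ | _) _)%N (2 ^ m)%N markov sum_bound => s N; nia.
Qed.

Lemma d_typ_is0 (R : realType) : d_typ_is phi (0%R : R).
Proof.
(* Shifting the index matches [harmonic m], which is [1 / (m + 1)]. *)
rewrite /d_typ_is -(cvg_shiftS (dn_typ R phi)).
have lim8 : ((fun m => 8 * harmonic m : R) @ \oo --> (0 : R))%R%classic.
  by rewrite -(mulr0 (8 : R)%R); apply: cvgMr; exact: cvg_harmonic.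
apply: squeeze_cvgr (cvg_cst 0%R) lim8; apply: nearW => m.
rewrite /dn_typ divr_ge0//=.
have g_gt0 : (0 < #|graphs m.+1|)%N.
  have e0P : is_graph ([ffun=> false] : {ffun 'I_m.+1 * 'I_m.+1 -> bool}).
    by apply/andP; split; do ?apply/forallP => ?; do ?apply/forallP => ?; rewrite !ffunE.
  by apply/card_gt0P; exists (Graph e0P); rewrite inE.
rewrite ler_pdivrMr ?ltr0n// /harmonic mulrAC ler_pdivlMr ?ltr0n//.
by rewrite -!natrM ler_nat card_typ_graphs.
Qed.

End FewNeighbourhoods.

Lemma solutions_none n (G : graph 'I_n) a :
  a \in solutions phi_none G -> neighbours G a \in [set finset.set0]%SET.
Proof.
rewrite !inE => /forallP /= isol; apply/eqP/setP => b.
by rewrite !inE; apply/negbTE/isol.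
Qed.

Lemma solutions_all n (G : graph 'I_n) a :
  a \in solutions phi_all G -> neighbours G a \in [set [set~ a]]%SET.
Proof.
rewrite !inE => /forallP /= adj_all; apply/eqP/setP => b; rewrite !inE.
have [->|neq_ba] := eqVneq b a; first exact: adjxx.
by have /implyP := adj_all b; rewrite /update /=; apply.
Qed.

Lemma solutions_one n (G : graph 'I_n) a :
  a \in solutions phi_one G ->
  neighbours G a \in [set [set b]%SET | b in 'I_n]%SET.
Proof.
rewrite !inE => /existsP[b] /andP[/= adj_ab /forallP uniq_b].
apply/imsetP; exists b => //; apply/setP => c; rewrite !inE.
apply/idP/eqP => [adj_ac|->//].
by have /implyP := uniq_b c; rewrite /update /= => /(_ adj_ac)/eqP.
Qed.

Theorem proposition6p1 (R : realType) :
  [/\ d_typ_is phi_none (0%R : R), d_typ_is phi_all (0%R : R)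
    & d_typ_is phi_one (0%R : R)].
Proof.
split.
- apply: d_typ_is0 solutions_none R => n a.
  (* The single admissible neighbourhood gives [1 <= n], as the node [a] forces [n] to be
     positive. *)
  by rewrite cards1 (leq_ltn_trans _ (ltn_ord a)).
- apply: d_typ_is0 solutions_all R => n a.
  by rewrite cards1 (leq_ltn_trans _ (ltn_ord a)).
- apply: d_typ_is0 solutions_one R => n a.
  (* There are at most [n] singletons, one for each possible unique neighbour. *)
  by rewrite -[leqRHS](card_ord n) leq_imset_card.
Qed.
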